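(* Let $d\geq 2$ and let $w$ be an infinite word. Each of the following conditions implies that the $2$-binomial complexity of $w$ equals its subword complexity, i.e. $b^2_w(n)=p_w(n)$ for every $n\in\mathbb{N}$: (i) $w$ is a $1$-balanced infinite word over a $d$-letter alphabet; (ii) $w$ is an infinite word over a $d$-letter alphabet with subword complexity $p_w(n)=n+(d-1)$ for every $n\in\mathbb{N}_{>0}$; (iii) $w$ is a hypercubic billiard word in dimension $d$; (iv) $w=\mathtt{color}(w_0,a,w_1)$, where $w_0\in\mathcal{A}^{\mathbb{N}}$ and $w_1\in\mathcal{B}^{\mathbb{N}}$ are Sturmian words over disjoint alphabets $\mathcal{A}$, $\mathcal{B}$ and $a\in\mathcal{A}$.
   Context: For a finite word $u$ and finite word $x$ over an alphabet, $\binom{u}{x}$ denotes the number of occurrences of $x$ in $u$ as a scattered (not necessarily contiguous) subword, with $\binom{u}{\epsilon}=1$. Two finite words $u,v$ are $k$-binomially equivalent ($k\in\mathbb{N}_{>0}$) if $\binom{u}{x}=\binom{v}{x}$ for every word $x$ of length at most $k$. For an infinite word $w$, $\mathcal{L}_n(w)$ is the set of its factors (contiguous subwords) of length $n$; the subword complexity is $p_w(n)=\#\mathcal{L}_n(w)$ and the $k$-binomial complexity $b^k_w(n)$ is the number of $k$-binomial equivalence classes in $\mathcal{L}_n(w)$. A word is $c$-balanced if for all equally long factors $u,v$ and every letter $a$, $||u|_a-|v|_a|\leq c$, where $|u|_a$ is the number of occurrences of $a$ in $u$. A Sturmian word is an infinite word with $p_w(n)=n+1$ for all $n\in\mathbb{N}$.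 A hypercubic billiard word in dimension $d$ is an infinite word over $\{1,\dots,d\}$ coding the sequence of hyperfaces successively hit by a billiard ball moving in straight lines with specular reflection inside the unit hypercube $[0,1]^d$ from some initial position $x$ with some initial momentum $\theta$ (arbitrary, no assumption on $\theta$), where the two parallel hyperfaces $\{x_i=0\}$ and $\{x_i=1\}$ are both labeled by the letter $i$. Coloring: given $w_0\in\mathcal{A}^{\mathbb{N}}$, $w_1\in\mathcal{B}^{\mathbb{N}}$ with $\mathcal{A}\cap\mathcal{B}=\emptyset$ and $a\in\mathcal{A}$, $\mathtt{color}(w_0,a,w_1)\in(\mathcal{A}\sqcup\mathcal{B}\setminus\{a\})^{\mathbb{N}}$ is defined (indexing from $0$) by $\mathtt{color}(w_0,a,w_1)[n]=w_0[n]$ if $w_0[n]\neq a$, and $=w_1[k-1]$ if $w_0[n]=a$ and $a$ occurs exactly $k$ times in $w_0[0]w_0[1]\cdots w_0[n]$; i.e. the successive occurrences of $a$ in $w_0$ are replaced by the successive letters of $w_1$. *)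

(* Defs.v *)
From HB Require Import structures.
From mathcomp Require Import all_boot all_order all_algebra.
From mathcomp Require Import boolp reals.

Set Implicit Arguments.
Unset Strict Implicit.
Unset Printing Implicit Defensive.

Import Order.TTheory GRing.Theory Num.Theory.

Section Words.
Variable T : finType.
Implicit Types (u v x : seq T) (w : nat -> T).

(* An occurrence of x in u as a scattered subword is a set of positions of u,
   encoded by its characteristic bit mask. *)
Definition binom u x : nat :=
  #|[set m : (size u).-tuple bool | mask m u == x]|.

Definition binom_equiv (k : nat) u v : Prop :=
  forall x, size x <= k -> binom u x = binom v x.

Definition factor_at w (i n : nat) : n.-tuple T := [tuple w (i + j) | j < n].

Definition factors w (n : nat) : {set n.-tuple T} :=
  [set u | `[< exists i, u = factor_at w i n >]].

Definition subword_complexity w (n : nat) : nat := #|factors w n|.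

Definition binom_complexity (k : nat) w (n : nat) : nat :=
  #|equivalence_partition (fun u v : n.-tuple T => `[< binom_equiv k u v >])
      (factors w n)|.

Definition balanced (c : nat) w : Prop :=
  forall (n : nat) (u v : n.-tuple T), u \in factors w n -> v \in factors w n ->
  forall a : T,
    (`| (count_mem a u)%:Z - (count_mem a v)%:Z | <= c%:Z)%R.

Definition sturmian w : Prop := forall n, subword_complexity w n = n + 1.

Definition word_over (A : {set T}) w : Prop := forall n, w n \in A.

Definition color (w0 : nat -> T) (a : T) (w1 : nat -> T) : nat -> T :=
  fun n => if w0 n == a then w1 (count_mem a (factor_at w0 0 n.+1) - 1)
           else w0 n.

End Words.

Section Billiard.
Local Open Scope ring_scope.
Variables (R : realType) (d : nat).
Implicit Types (p th : 'rV[R]_d) (i : 'I_d).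

Definition in_cube p : Prop := forall i, 0 <= p 0 i <= 1.

(* The ball at position p with momentum th is hitting one of the two hyperfaces
   labeled i: it is on that hyperface and its momentum points outwards.  A ball
   leaving a hyperface, or sliding inside it (th 0 i = 0), is not hitting it. *)
Definition hits p th i : Prop :=
  (p 0 i = 0 /\ th 0 i < 0) \/ (p 0 i = 1 /\ 0 < th 0 i).

Definition reflect_mom i th : 'rV[R]_d :=
  \row_j (if j == i then - th 0 j else th 0 j).

(* p n and th n are the position and the momentum just after the n-th bounce
   (the initial ones for n = 0), and tau n is the time elapsed between the n-th
   and (n+1)-st bounces.  As the ball stays in the cube, no hyperface can be hit
   strictly between these two bounces.  The hyperfaces are hit one at a time:
   a trajectory into the intersection of two non-parallel hyperfaces has no
   coding. *)
Definition billiard_coding (x theta : 'rV[R]_d) (w : nat -> 'I_d) : Prop :=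
  exists (p th : nat -> 'rV[R]_d) (tau : nat -> R),
    [/\ p 0%N = x, th 0%N = theta &
        forall n : nat,
          [/\ 0 <= tau n,
              p n.+1 = p n + tau n *: th n,
              in_cube (p n.+1),
              (forall i, hits (p n.+1) (th n) i <-> i = w n) &
              th n.+1 = reflect_mom (w n) (th n)]].

Definition billiard_word (w : nat -> 'I_d) : Prop :=
  exists x theta : 'rV[R]_d, in_cube x /\ billiard_coding x theta w.

End Billiard.

(* Main.v *)
Require Import Defs.
From HB Require Import structures.
From mathcomp Require Import all_boot all_order all_algebra.
From mathcomp Require Import boolp reals.
From mathcomp Require Import zify lra.

Set Implicit Arguments.
Unset Strict Implicit.
Unset Printing Implicit Defensive.

(** Erase from two 2-binomially equivalent factors all letters outside two
    disjoint classes of letters, and merge each class into one letter.  The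
    resulting binary words have the same number of occurrences of each letter
    and of each pair of letters; if moreover all binary words obtained in this
    way from the factors of [w] are 1-balanced, then the difference of the
    prefix counts of the two words keeps a constant sign and has sum zero, so
    the two words are equal.  Hence the theorem holds as soon as any two letters
    of [w] are separated by two classes with 1-balanced projections.

    For (i)-(iii) two singletons do.  In (iii) a factor read during a time [t]
    contains [i] about [t |theta_i|] times, up to an error of one; in (ii) the
    projection to two letters is either deterministic or inherits the uniqueness
    of right special factors and aperiodicity, hence is balanced by the argument
    of Coven and Hedlund.  For (iv) singletons do not suffice: one uses [{x}]
    against its complement for a letter [x] of the first word, and [{x}] against
    the other letters of the second word for a letter [x] of that word. *)

(** * Binomial coefficients and balanced binary words *)

(** The number of pairs of positions p < q with a letter of [al] at p and a letter of [be] at q. It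
    extends the coefficient of a two-letter word to classes of letters. *)
Fixpoint pairs (T : Type) (al be : pred T) (s : seq T) : nat :=
  if s is x :: s' then al x * count be s' + pairs al be s' else 0.

Section Binomials.
Variable T : finType.
Implicit Types (u v x : seq T) (a b y : T).

(** Masks are split by their first bit: [y] is either kept or dropped. *)
Lemma binom_cons y u x :
  binom (y :: u) x =
  #|[set m : (size u).-tuple bool | y :: mask m u == x]| + binom u x.
Proof.
rewrite /binom.
set A := [set m : (size u).-tuple bool | y :: mask m u == x].
set B := [set m : (size u).-tuple bool | mask m u == x].
have cons_inj (c : bool) :
    injective (fun m : (size u).-tuple bool => [tuple of c :: m]).
  by move=> m1 m2 /(congr1 val) /= [] /val_inj.
have -> : [set m : (size (y :: u)).-tuple bool | mask m (y :: u) == x] =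
    [set [tuple of true :: m] | m : (size u).-tuple bool in A] :|:
    [set [tuple of false :: m] | m : (size u).-tuple bool in B].
  apply/setP=> m; rewrite !inE; apply/idP/orP.
  - case/tupleP: m => -[] m /= hm; [left|right].
      by apply/imsetP; exists m; rewrite ?inE //; apply: val_inj.
    by apply/imsetP; exists m; rewrite ?inE //; apply: val_inj.
  - by case=> /imsetP[m' + ->]; rewrite inE.
rewrite cardsU !card_imset //.
suff -> : [set [tuple of true :: m] | m : (size u).-tuple bool in A] :&:
    [set [tuple of false :: m] | m : (size u).-tuple bool in B] = set0.
  by rewrite cards0 subn0.
apply/setP=> m; rewrite !inE; apply/negbTE/negP.
by case/andP=> /imsetP[m1 _ ->] /imsetP[m2 _ /(congr1 val)].
Qed.

Lemma binom_nil u : binom u [::] = 1.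
Proof.
elim: u => [|y u IH].
  rewrite /binom (_ : [set _ | _] = setT) ?cardsT ?card_tuple //.
  by apply/setP=> m; rewrite !inE mask0.
by rewrite binom_cons IH (_ : [set _ | _] = set0) ?cards0.
Qed.

Lemma binom_cons_cons y u b x :
  binom (y :: u) (b :: x) = (y == b) * binom u x + binom u (b :: x).
Proof.
rewrite binom_cons; congr (_ + _); rewrite /binom.
case: eqP => [->|ne]; rewrite ?mul1n ?mul0n.
  by apply: eq_card => m; rewrite !inE eqseq_cons eqxx.
apply/eqP; rewrite cards_eq0; apply/eqP/setP=> m; rewrite !inE eqseq_cons.
by case: eqP.
Qed.

Lemma binom_nil_cons b x : binom [::] (b :: x) = 0.
Proof.
apply/eqP; rewrite cards_eq0; apply/eqP/setP=> m; rewrite !inE.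
by rewrite mask0.
Qed.

Lemma binom1 u a : binom u [:: a] = count_mem a u.
Proof.
elim: u => [|y u IH]; first by rewrite binom_nil_cons.
by rewrite binom_cons_cons IH binom_nil muln1.
Qed.

Lemma binom2 u a b : binom u [:: a; b] = pairs (pred1 a) (pred1 b) u.
Proof.
elim: u => [|y u IH] /=; first by rewrite binom_nil_cons.
by rewrite binom_cons_cons IH binom1.
Qed.

Lemma sum_pred1 (be : pred T) y : \sum_(b | be b) (y == b) = be y.
Proof.
rewrite big_mkcond (bigD1 y) //= eqxx big1 ?addn0; first by case: (be y).
by move=> i /negbTE; rewrite eq_sym => ->; case: (be i).
Qed.

Lemma count_sum_mem (be : pred T) u : count be u = \sum_(b | be b) count_mem b u.
Proof.
elim: u => [|y u IH] /=; first by rewrite big1.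
by rewrite big_split /= sum_pred1 IH.
Qed.

Lemma pairs_sum (al be : pred T) u :
  pairs al be u =
  \sum_(a | al a) \sum_(b | be b) pairs (pred1 a) (pred1 b) u.
Proof.
elim: u => [|y u IH] /=.
  by rewrite big1 // => a _; rewrite big1.
under eq_bigr => a _ do rewrite big_split /= -big_distrr /=.
by rewrite big_split /= -big_distrl /= sum_pred1 -count_sum_mem IH.
Qed.

Lemma binom_equiv_count u v (al : pred T) :
  binom_equiv 2 u v -> count al u = count al v.
Proof.
move=> h; rewrite !count_sum_mem; apply: eq_bigr => a _.
by rewrite -!binom1 h.
Qed.

(** Summing over the letters of both classes reduces the claim to coefficients of words of length
    two. *)
Lemma binom_equiv_pairs u v (al be : pred T) :
  binom_equiv 2 u v -> pairs al be u = pairs al be v.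
Proof.
move=> h; rewrite !(pairs_sum al be); apply: eq_bigr => a _.
by apply: eq_bigr => b _; rewrite -!binom2 h.
Qed.

End Binomials.

Section BinaryWords.
Implicit Types U V : seq bool.

Lemma eq_prefix_count U V :
  size U = size V ->
  (forall k, k <= size U -> count id (take k U) = count id (take k V)) -> U = V.
Proof.
elim: U V => [|x U IH] [|y V] //= [sUV] h.
have exy : x = y by have := h 1 isT; rewrite /= !take0 /=; case: x {h}; case: y.
congr (_ :: _) => //; apply: IH => // k hk.
by have /= := h k.+1 hk; rewrite exy => /addnI.
Qed.

(** A [true] at position p lies in the proper prefixes of length greater than p, and there are as
    many of these as positions after p. *)
Lemma pairs_predT U : pairs id predT U = \sum_(k < size U) count id (take k U).
Proof.
elim: U => [|x U IH] /=; first by rewrite big_ord0.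
rewrite big_ord_recl /= add0n big_split /= IH sum_nat_const card_ord count_predT.
by rewrite mulnC.
Qed.

Lemma pairs_id U : (pairs id id U).*2 + count id U = count id U ^ 2.
Proof. by elim: U => [|x U IH] //=; case: x => /=; nia. Qed.

Lemma pairs_predT_split U : pairs id predT U = pairs id id U + pairs id negb U.
Proof.
elim: U => [|x U IH] //=; rewrite count_predT -(count_predC id U) IH.
by rewrite (@eq_count _ (predC id) negb) //; case: x => /=; lia.
Qed.

(* The difference of the prefix counts never takes values of both signs, while
   its sum is determined by the binomial coefficients. *)
Lemma balanced_binom_eq U V :
  size U = size V -> count id U = count id V ->
  pairs id negb U = pairs id negb V ->
  (forall i n, i + n <= size U ->
     (count id (take n (drop i U)) <= (count id (take n (drop i V))).+1) /\
     (count id (take n (drop i V)) <= (count id (take n (drop i U))).+1)) ->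
  U = V.
Proof.
move=> sUV cUV pUV bal.
pose f W k := count id (take k W).
have fD W i n : f W (i + n) = f W i + count id (take n (drop i W)).
  by rewrite /f takeD count_cat.
(* [pairs id id] depends only on the number of [true], and [pairs id negb] agrees by assumption, so
   [pairs id predT], the sum of the prefix counts, agrees too. *)
have sum_eq : \sum_(k < size U) f U k = \sum_(k < size U) f V k.
  have := pairs_id U; have := pairs_id V; have := pairs_predT_split U.
  have := pairs_predT_split V; rewrite !pairs_predT -sUV cUV pUV /f; lia.
have mono W W' : \sum_(k < size U) f W k = \sum_(k < size U) f W' k ->
    (forall k, k < size U -> f W k <= f W' k) ->
    forall k, k < size U -> f W k = f W' k.
  move=> e le k hk; apply/eqP; rewrite eqn_leq le //=.
  move: e; rewrite (bigD1 (Ordinal hk)) //= [RHS](bigD1 (Ordinal hk)) //=.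
  have : \sum_(i < size U | i != Ordinal hk) f W i <=
         \sum_(i < size U | i != Ordinal hk) f W' i.
    by apply: leq_sum => i _; exact: le.
  move: (\sum_(i < size U | _) _) (\sum_(i < size U | _) _) => s1 s2; lia.
(* If the difference had opposite signs at i and j, the blocks of [U] and [V] between i and j would
   have counts at least 2 apart. *)
have key : (forall k, k < size U -> f U k <= f V k) \/
           (forall k, k < size U -> f V k <= f U k).
  apply: contrapT => /not_orP[/existsNP[i /not_implyP[hi /negP ni]]].
  case/existsNP=> j /not_implyP[hj /negP nj].
  have [ij|ji] := leqP i j.
    have := fD U i (j - i); have := fD V i (j - i); rewrite subnKC //.
    have [|] := bal i (j - i); lia.
  have := fD U j (i - j); have := fD V j (i - j); rewrite subnKC; last by lia.
  have [|] := bal j (i - j); lia.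
have eq_lt k : k < size U -> f U k = f V k.
  case: key => key; first exact: mono.
  by move=> hk; symmetry; move: k hk; apply: mono.
apply: eq_prefix_count => // k; rewrite leq_eqVlt => /predU1P[->|]; last exact: eq_lt.
by rewrite {2}sUV !take_size.
Qed.

End BinaryWords.

(** * Factors as lists and their projections to two classes of letters *)

Definition fac (T : Type) (w : nat -> T) (i n : nat) : seq T := map w (iota i n).

(** For disjoint classes this is 1-balance of the projected words: the windows may have different
    lengths in [w], only their projections are equally long. One inequality suffices since the
    windows can be swapped. *)
Definition pair_balanced (T : Type) (w : nat -> T) (al be : pred T) : Prop :=
  forall i n j m,
    count (predU al be) (fac w i n) = count (predU al be) (fac w j m) ->
    count al (fac w i n) <= (count al (fac w j m)).+1.

Section Projections.
Variable T : eqType.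
Implicit Types (u v : seq T) (al be p : pred T).

Definition proj al be u : seq bool := map al (filter (predU al be) u).

Lemma proj_cut al be u U V :
  proj al be u = U ++ V ->
  exists u1 u2, [/\ u = u1 ++ u2, proj al be u1 = U & proj al be u2 = V].
Proof.
rewrite /proj; elim: u U => [|x u IH] U.
  by case: U V => [|? ?] // [] // _; exists [::], [::].
rewrite [filter _ _]/=; case px: (al x || be x).
  case: U => [|y U] /=.
    by move=> <-; exists [::], (x :: u); rewrite /= px.
  case=> <- /IH[u1 [u2 [-> <- <-]]]; exists (x :: u1), u2.
  by rewrite /= px.
by move=> /IH[u1 [u2 [-> <- <-]]]; exists (x :: u1), u2; rewrite /= px.
Qed.

Lemma size_proj al be u : size (proj al be u) = count (predU al be) u.
Proof. by rewrite size_map size_filter. Qed.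

Lemma count_proj al be u : count id (proj al be u) = count al u.
Proof.
rewrite count_map count_filter; apply: eq_count => x /=.
by case: (al x).
Qed.

Lemma pairs_proj al be u :
  (forall x, al x -> ~~ be x) -> pairs id negb (proj al be u) = pairs al be u.
Proof.
move=> dis; elim: u => [|x u IH] //=; rewrite /proj /= -/(proj al be u).
have cb : count negb (proj al be u) = count be u.
  rewrite count_map count_filter; apply: eq_count => y /=.
  by case ay: (al y) => //=; apply/esym/negbTE/dis.
case ax: (al x) => /=; first by rewrite IH cb ax.
by case: (be x); rewrite /= ?ax IH.
Qed.

(* If [u] and [v] first differ by letters [x] and [y], the projection that
   separates [x] from [y] tells them apart. *)
Lemma eq_from_proj u v :
  size u = size v ->
  (forall x y, x \in u -> y \in v -> x != y ->
     exists al be, [/\ al x, be y, (forall t, al t -> ~~ be t) &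
                       proj al be u = proj al be v]) ->
  u = v.
Proof.
move=> suv sep.
(* Here [l] is the longest common prefix: the remainders are both empty or start with different
   letters. *)
have [l [u' [v' [eu ev hd]]]] : exists l u' v', [/\ u = l ++ u', v = l ++ v' &
    if u' is x :: _ then if v' is y :: _ then x != y else false else v' == [::]].
  elim: u v suv {sep} => [|x u IH] [|y v] //=.
    by move=> _; exists [::], [::], [::].
  case=> /IH[l [u' [v' [-> -> h]]]].
  have [->|ne] := eqVneq x y; first by exists (y :: l), u', v'.
  by exists [::], (x :: l ++ u'), (y :: l ++ v').
case: u' v' eu ev hd => [|x u'] [|y v'] // eu ev ne; first by rewrite eu ev.
have xu : x \in u by rewrite eu mem_cat mem_head orbT.
have yv : y \in v by rewrite ev mem_cat mem_head orbT.
have [al [be [ax by_ dis]]] := sep x y xu yv ne.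
rewrite /proj eu ev !filter_cat /= ax by_ orbT !map_cat /= => /eqP.
rewrite eqseq_cat // eqxx /= ax.
by case ay: (al y) => //; have := dis y ay; rewrite by_.
Qed.

End Projections.

Section Factors.
Variable T : Type.
Implicit Types w : nat -> T.

Lemma size_fac w i n : size (fac w i n) = n.
Proof. by rewrite size_map size_iota. Qed.

Lemma facD w i n m : fac w i (n + m) = fac w i n ++ fac w (i + n) m.
Proof. by rewrite /fac iotaD map_cat. Qed.

Lemma facS w i n : fac w i n.+1 = w i :: fac w i.+1 n.
Proof. by []. Qed.

Lemma facSr w i n : fac w i n.+1 = rcons (fac w i n) (w (i + n)).
Proof. by rewrite -addn1 facD cats1. Qed.

Lemma nth_fac x0 w i n k : k < n -> nth x0 (fac w i n) k = w (i + k).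
Proof. by move=> hk; rewrite (nth_map 0) ?size_iota // nth_iota. Qed.

Lemma fac_catP w i n u1 u2 :
  fac w i n = u1 ++ u2 -> u1 = fac w i (size u1) /\
  u2 = fac w (i + size u1) (size u2).
Proof.
move=> e; have en : n = size u1 + size u2 by rewrite -size_cat -e size_fac.
move: e; rewrite en facD => e; split.
  by have := congr1 (take (size u1)) e; rewrite !take_size_cat ?size_fac.
by have := congr1 (drop (size u1)) e; rewrite !drop_size_cat ?size_fac.
Qed.

End Factors.

Section FactorsEq.
Variable T : eqType.
Implicit Types w : nat -> T.

Lemma eq_facP w (w' : nat -> T) i j n :
  (forall k, k < n -> w (i + k) = w' (j + k)) <-> fac w i n = fac w' j n.
Proof.
split=> [h|e k hk]; last first.
  by rewrite -(nth_fac (w 0) _ _ hk) -(nth_fac (w 0) w' _ hk) e.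
apply: (@eq_from_nth _ (w 0)); rewrite !size_fac // => k hk.
by rewrite !nth_fac // h.
Qed.

Lemma mem_fac w i n x : x \in fac w i n -> exists k, x = w k.
Proof. by case/mapP=> k _ ->; exists k. Qed.

(** Makes the projections of factors a factor-closed language, so that balance of [w] controls every
    block inside a projection. *)
Lemma proj_infix w al be i n U1 U2 U3 :
  proj al be (fac w i n) = U1 ++ U2 ++ U3 ->
  exists j m, U2 = proj al be (fac w j m).
Proof.
case/proj_cut=> u1 [u23 [+ _ /proj_cut[u2 [u3 [e23 e2 _]]]]].
case/fac_catP=> _; rewrite e23 => /esym /fac_catP[e _].
by rewrite -e2 e; eexists; eexists.
Qed.

Lemma proj_infix_ex w al be i n k m :
  exists j l, take m (drop k (proj al be (fac w i n))) = proj al be (fac w j l).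
Proof.
set U := proj _ _ _.
apply: (@proj_infix w al be i n (take k U) _ (drop m (drop k U))).
by rewrite !cat_take_drop.
Qed.

Lemma count_pred2 (a b : T) u : a != b ->
  count (predU (pred1 a) (pred1 b)) u = count_mem a u + count_mem b u.
Proof.
move=> ab; elim: u => //= x u ->; have [->|_] := eqVneq x a.
  by rewrite (negbTE ab) /=; lia.
by case: (x == b) => /=; lia.
Qed.

(** If the first window is the shorter one, extending the second only adds occurrences of [a].
    Otherwise the same comparison for [b], with the windows exchanged, bounds [a] because the totals
    agree. *)
Lemma equal_length_pair_balanced w a b :
  a != b ->
  (forall c i j n, count_mem c (fac w i n) <= (count_mem c (fac w j n)).+1) ->
  pair_balanced w (pred1 a) (pred1 b).
Proof.
move=> ab bal i n j m; rewrite !count_pred2 //.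
have mono c k s t : s <= t -> count_mem c (fac w k s) <= count_mem c (fac w k t).
  by move=> /subnKC <-; rewrite facD count_cat leq_addr.
have [nm|/ltnW mn] := leqP n m.
  by have := bal a i j n; have := mono a j n m nm; lia.
by have := bal b j i m; have := mono b i m n mn; lia.
Qed.

End FactorsEq.

(** * Reduction to balanced projections *)

Section Main.
Variable T : finType.
Implicit Types (w : nat -> T) (al be : pred T).

Lemma val_factor_at w i n : factor_at w i n = fac w i n :> seq T.
Proof.
rewrite /factor_at /= /fac -[i in iota i]addn0 iotaDl -map_comp -val_enum_ord.
by rewrite -map_comp.
Qed.

Lemma factor_atP w n u : reflect (exists i, u = factor_at w i n) (u \in factors w n).
Proof. by rewrite inE; apply: asboolP. Qed.

Lemma mem_factor_at w i n : factor_at w i n \in factors w n.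
Proof. by apply/factor_atP; exists i. Qed.

Lemma pair_balanced_proj w al be i j n :
  (forall t, al t -> ~~ be t) -> pair_balanced w al be ->
  binom_equiv 2 (fac w i n) (fac w j n) ->
  proj al be (fac w i n) = proj al be (fac w j n).
Proof.
move=> dis bal eqv.
apply: balanced_binom_eq.
- by rewrite !size_proj; apply: binom_equiv_count.
- by rewrite !count_proj; apply: binom_equiv_count.
- by rewrite !pairs_proj //; apply: binom_equiv_pairs.
move=> k m km.
have sz : size (proj al be (fac w i n)) = size (proj al be (fac w j n)).
  by rewrite !size_proj; apply: binom_equiv_count.
have [i' [n' ei]] := proj_infix_ex w al be i n k m.
have [j' [m' ej]] := proj_infix_ex w al be j n k m.
have := congr1 size ei; have := congr1 size ej.
rewrite !size_takel ?size_drop ?leq_subRL -?sz ?(leq_trans (leq_addr _ _) km) //.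
rewrite ei ej !count_proj !size_proj => e1 e2.
by split; apply: bal; rewrite -e1 -e2.
Qed.

(** The map from a factor to its class is injective: equivalent factors have equal projections for
    every separating pair of classes, hence coincide by [eq_from_proj]. *)
Lemma binom_complexity_eq w :
  (forall i j, w i != w j ->
     exists al be, [/\ al (w i), be (w j), (forall t, al t -> ~~ be t) &
                       pair_balanced w al be]) ->
  forall n, binom_complexity 2 w n = subword_complexity w n.
Proof.
move=> sep n; rewrite /binom_complexity /subword_complexity.
rewrite /equivalence_partition card_in_imset // => u v uF vF /setP/(_ u).
rewrite !inE in uF vF *; rewrite uF /=.
have -> : `[< binom_equiv 2 u u >] by apply/asboolP.
move/esym/asboolP; case/asboolP: vF => i ->; case/asboolP: uF => j -> eqv.
apply: val_inj; rewrite /= !val_factor_at in eqv *.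
apply/esym/eq_from_proj; rewrite ?size_fac // => x y /mem_fac[k ->] /mem_fac[l ->].
case/sep=> al [be [ax by_ dis bal]]; exists al, be; split=> //.
exact: pair_balanced_proj.
Qed.

Lemma balanced1_pair_balanced w a b :
  balanced 1 w -> a != b -> pair_balanced w (pred1 a) (pred1 b).
Proof.
move=> bal ab; apply: equal_length_pair_balanced => // c i j n.
have := bal n _ _ (mem_factor_at w i n) (mem_factor_at w j n) c; rewrite !val_factor_at.
by move: (count_mem c (fac w i n)) (count_mem c (fac w j n)) => x y; lia.
Qed.

End Main.

(** * Billiard words *)

Section Billiard.
Import Order.TTheory GRing.Theory Num.Theory.
Local Open Scope ring_scope.
Variables (R : realType) (d : nat).
Variables (p th : nat -> 'rV[R]_d) (tau : nat -> R) (w : nat -> 'I_d).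
Hypothesis p0_cube : in_cube (p 0).
Hypothesis bounce : forall n : nat,
  [/\ 0 <= tau n, p n.+1 = p n + tau n *: th n, in_cube (p n.+1),
      (forall i, hits (p n.+1) (th n) i <-> i = w n) &
      th n.+1 = reflect_mom (w n) (th n)].

Definition elapsed (m n : nat) : R := \sum_(m <= k < m + n) tau k.

(* The fraction of the unit segment already travelled by the [i]-th coordinate
   since its last reflection. *)
Definition phase (i : 'I_d) (n : nat) : R :=
  if 0 < th n 0 i then p n 0 i else 1 - p n 0 i.

Lemma in_cube_p n : in_cube (p n).
Proof. by case: n => [//|n]; case: (bounce n). Qed.

Lemma speed_const i n : `|th n 0 i| = `|th 0 0 i|.
Proof.
elim: n => // n <-; case: (bounce n) => _ _ _ _ ->.
by rewrite mxE; case: eqP => // _; rewrite normrN.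
Qed.

Lemma phase_ge0 i n : 0 <= phase i n.
Proof. by have := in_cube_p n i; rewrite /phase; case: ifP => _; lra. Qed.

(** The phase grows at constant speed and drops from 1 to 0 at a reflection. It stays strictly below
    1 otherwise, since reaching the face with outward momentum would be a hit. *)
Lemma phase_step i n : th 0 0 i != 0 ->
  phase i n.+1 + (w n == i)%:R = phase i n + `|th 0 0 i| * tau n /\
  phase i n.+1 < 1.
Proof.
move=> nz; have thn0 : th n 0 i != 0 by rewrite -normr_eq0 speed_const normr_eq0.
rewrite -(speed_const i n) /phase; case: (bounce n) => t0 -> cube hit ->.
have := hit i; have := cube i; have := in_cube_p n i.
case: (bounce n) => _ -> _ _ _; rewrite /hits !mxE [w n == i]eq_sym.
case: eqP => [<-|ne] c1 c2.
  case=> _ /(_ erefl) [[e lt0]|[e gt0]].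
    by rewrite oppr_gt0 lt0 ltNge (ltW lt0) /= ltr0_norm //; lra.
  by rewrite oppr_gt0 (gtr0_norm gt0) gt0 ltNge (ltW gt0) /=; lra.
case=> nohit _; rewrite mulr0n addr0; case: ltP => s; last first.
  have {}s : th n 0 i < 0 by rewrite lt_neqAle thn0.
  rewrite (ltr0_norm s); split; first by lra.
  suff : 0 < p n 0 i + tau n * th n 0 i by lra.
  rewrite lt_neqAle; apply/andP; split; last by lra.
  by apply/eqP => e; apply: ne; apply: nohit; left.
rewrite (gtr0_norm s); split; first by lra.
rewrite lt_neqAle; apply/andP; split; last by lra.
by apply/eqP => e; apply: ne; apply: nohit; right.
Qed.

Lemma count_phase i m n : th 0 0 i != 0 ->
  phase i (m + n) + (count_mem i (fac w m n))%:R =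
  phase i m + `|th 0 0 i| * elapsed m n.
Proof.
move=> nz; elim: n => [|n IH].
  by rewrite addn0 /elapsed addn0 big_geq //= mulr0.
have [step _] := phase_step (m + n) nz.
have -> : elapsed m n.+1 = elapsed m n + tau (m + n).
  by rewrite /elapsed addnS big_nat_recr //= leq_addr.
rewrite facSr -cats1 count_cat /= addn0 natrD addnS mulrDr.
by move: step IH; lra.
Qed.

(** The count is speed times time plus a difference of two phases. One bound is strict, so that
    counts over comparable times differ by at most one. *)
Lemma count_bounds i m n :
  (count_mem i (fac w m n))%:R <= `|th 0 0 i| * elapsed m n + 1 /\
  `|th 0 0 i| * elapsed m n < (count_mem i (fac w m n))%:R + 1.
Proof.
have [z|nz] := eqVneq (th 0 0 i) 0.
  suff -> : count_mem i (fac w m n) = 0%N.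
    by rewrite z normr0 mul0r; lra.
  apply/count_memPn/negP => /mapP[k _ e].
  have : hits (p k.+1) (th k) i by case: (bounce k) => _ _ _ h _; apply/h.
  have : th k 0 i = 0 by apply/eqP; rewrite -normr_eq0 speed_const z normr0.
  by rewrite /hits => ->; rewrite ltxx => -[[]|[]].
(* A nonempty window ends just after a bounce, where the phase is below 1; the initial phase may
   equal 1, so the empty window is treated apart. *)
case: n => [|n].
  by rewrite /elapsed addn0 big_geq //= mulr0; lra.
have := count_phase m n.+1 nz; have := phase_ge0 i m.
have := phase_ge0 i (m + n.+1).
have [_ h1] := phase_step (m + n) nz; rewrite -addnS in h1.
have h2 : phase i m <= 1.
  by have := in_cube_p m i; rewrite /phase; case: ifP => _; lra.
lra.
Qed.

(** Windows are compared by elapsed time. If the first lasts longer, the bound is applied to [b] and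
    carried over to [a] by the equality of totals. *)
Lemma billiard_pair_balanced a b : a != b -> pair_balanced w (pred1 a) (pred1 b).
Proof.
move=> ab i n j m; rewrite !count_pred2 //.
have aux c k s l t : elapsed k s <= elapsed l t ->
    (count_mem c (fac w k s) <= (count_mem c (fac w l t)).+1)%N.
  move=> le; have [h1 _] := count_bounds c k s; have [_ h2] := count_bounds c l t.
  have h3 : `|th 0 0 c| * elapsed k s <= `|th 0 0 c| * elapsed l t.
    by apply: ler_wpM2l.
  by rewrite -ltnS -(ltr_nat R) -addn2 natrD; lra.
have [/aux h|/ltW /aux h] := lerP (elapsed i n) (elapsed j m).
  by move=> _; apply: h.
have := h b; move: (count_mem a (fac w i n)) (count_mem a (fac w j m)).
by move: (count_mem b (fac w i n)) (count_mem b (fac w j m)); lia.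
Qed.

End Billiard.

(** * Right special factors and balance *)

(** At most one factor of each length has two different continuations; the pairs [i], [i'] and [j],
    [j'] witness two such factors. *)
Definition uniq_right_special (T : Type) (w : nat -> T) : Prop :=
  forall n i i' j j',
    fac w i n = fac w i' n -> w (i + n) <> w (i' + n) ->
    fac w j n = fac w j' n -> w (j + n) <> w (j' + n) ->
    fac w i n = fac w j n.

(** Excludes eventual periodicity: every period [q] fails arbitrarily far. *)
Definition aperiodic (T : Type) (w : nat -> T) : Prop :=
  forall N q, 0 < q -> exists2 n, N <= n & w (n + q) <> w n.

Section Complexity.
Variables (T : finType) (w : nat -> T).

Definition tuple_belast n (u : n.+1.-tuple T) : n.-tuple T :=
  [tuple tnth u (widen_ord (leqnSn n) k) | k < n].

Lemma tuple_belast_factor i n :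
  tuple_belast (factor_at w i n.+1) = factor_at w i n.
Proof. by apply: eq_from_tnth => k; rewrite !tnth_mktuple. Qed.

Lemma factor_at_eq i j n :
  (factor_at w i n = factor_at w j n) <-> (fac w i n = fac w j n).
Proof.
split=> [/(congr1 val)|e]; first by rewrite /= !val_factor_at.
by apply: val_inj; rewrite /= !val_factor_at.
Qed.

Lemma fac_succ_eq i j n :
  (fac w i n.+1 = fac w j n.+1) <-> (fac w i n = fac w j n /\ w (i + n) = w (j + n)).
Proof.
rewrite !facSr; split=> [/eqP|[-> -> //]].
by rewrite eqseq_rcons => /andP[/eqP -> /eqP ->].
Qed.

(** Deleting the last letter still maps onto the factors of length [n] after [u] and [v] are
    removed. *)
Lemma complexity_add2 n u v :
  u \in factors w n.+1 -> v \in factors w n.+1 -> u <> v ->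
  (forall i, exists j, [/\ factor_at w j n = factor_at w i n,
     factor_at w j n.+1 <> u & factor_at w j n.+1 <> v]) ->
  (subword_complexity w n).+2 <= subword_complexity w n.+1.
Proof.
move=> uF vF uv h.
have sub : [set u; v] \subset factors w n.+1.
  by apply/subsetP=> x; rewrite in_set2 => /orP[] /eqP ->.
rewrite /subword_complexity -(cardsID [set u; v] (factors w n.+1)).
rewrite (setIidPr sub) cards2; move/eqP: uv => -> /=; rewrite addSn addSn add0n !ltnS.
apply: leq_trans (leq_imset_card (@tuple_belast n) _).
apply/subset_leq_card/subsetP=> x /factor_atP[i ->]; have [j [<- ju jv]] := h i.
rewrite -tuple_belast_factor; apply: imset_f.
rewrite in_setD mem_factor_at andbT !inE negb_or.
by apply/andP; split; apply/eqP.
Qed.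

Hypothesis ap : forall n, 0 < n -> n < subword_complexity w n.

(** The Morse-Hedlund argument: with period [q] from [N] on, every factor already starts before
    [N + q], which leaves at most [N + q] factors of that length. *)
Lemma complexity_aperiodic : aperiodic w.
Proof.
move=> N q q0; apply: contrapT => h.
have per k : N <= k -> w (k + q) = w k.
  by move=> Nk; apply: contrapT => ne; apply: h; exists k.
pose n := N + q.
have red i : exists2 i', i' < n & fac w i n = fac w i' n.
  elim/ltn_ind: i => i IH; have [lt|ge] := ltnP i n; first by exists i.
  have [|i' lt e] := IH (i - q); first by lia.
  exists i' => //; rewrite -e; apply/eq_facP => k _.
  by rewrite -(per (i - q + k)); [congr w; lia | lia].
suff : subword_complexity w n <= n by have := ap (n := n); lia.
rewrite -{2}(card_ord n) -cardsT.
apply: leq_trans (leq_imset_card (fun i : 'I_n => factor_at w i n) _).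
apply/subset_leq_card/subsetP=> x /factor_atP[i ->].
have [i' lt e] := red i; apply/imsetP; exists (Ordinal lt) => //.
by apply/factor_at_eq.
Qed.

End Complexity.

Section ComplexityStep.
Variables (T : finType) (w : nat -> T) (n : nat).
Hypothesis step : subword_complexity w n.+1 = (subword_complexity w n).+1.

(** Two distinct right special factors would each contribute an additional extension, making the
    complexity grow by at least 2. *)
Lemma step_uniq_right_special i i' j j' :
  fac w i n = fac w i' n -> w (i + n) <> w (i' + n) ->
  fac w j n = fac w j' n -> w (j + n) <> w (j' + n) ->
  fac w i n = fac w j n.
Proof.
move=> ei ni ej nj; apply: contrapT => ne.
suff : (subword_complexity w n).+2 <= subword_complexity w n.+1.
  by rewrite step ltnn.
apply: (@complexity_add2 _ _ _ (factor_at w i' n.+1) (factor_at w j' n.+1));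
  rewrite ?mem_factor_at //.
  by move/factor_at_eq/fac_succ_eq => [e _]; apply: ne; rewrite ei e.
move=> k; have [ki|nki] := pselect (fac w k n.+1 = fac w i' n.+1).
  exists i; split.
  - by apply/factor_at_eq; rewrite ei; case/fac_succ_eq: ki.
  - by move/factor_at_eq/fac_succ_eq => [].
  - by move/factor_at_eq/fac_succ_eq => [e _]; apply: ne; rewrite e.
have [kj|nkj] := pselect (fac w k n.+1 = fac w j' n.+1).
  exists j; split.
  - by apply/factor_at_eq; rewrite ej; case/fac_succ_eq: kj.
  - by move/factor_at_eq/fac_succ_eq => [e _]; apply: ne; rewrite ei e.
  - by move/factor_at_eq/fac_succ_eq => [].
by exists k; split=> // /factor_at_eq.
Qed.

Lemma step_two_extensions i j k :
  fac w i n = fac w j n -> fac w i n = fac w k n ->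
  w (i + n) <> w (j + n) -> w (k + n) = w (i + n) \/ w (k + n) = w (j + n).
Proof.
move=> ej ek nij; apply: contrapT => /not_orP[nki nkj].
suff : (subword_complexity w n).+2 <= subword_complexity w n.+1.
  by rewrite step ltnn.
apply: (@complexity_add2 _ _ _ (factor_at w j n.+1) (factor_at w k n.+1));
  rewrite ?mem_factor_at //.
  by move/factor_at_eq/fac_succ_eq => [_ /esym].
have i_ok : factor_at w i n.+1 <> factor_at w j n.+1 /\
            factor_at w i n.+1 <> factor_at w k n.+1.
  by split=> /factor_at_eq/fac_succ_eq[_ e]; [apply: nij | apply: nki].
move=> l; have [lj|nlj] := pselect (fac w l n.+1 = fac w j n.+1).
  exists i; split; try by case: i_ok.
  by apply/factor_at_eq; rewrite ej; case/fac_succ_eq: lj.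
have [lk|nlk] := pselect (fac w l n.+1 = fac w k n.+1).
  exists i; split; try by case: i_ok.
  by apply/factor_at_eq; rewrite ek; case/fac_succ_eq: lk.
by exists l; split=> // /factor_at_eq.
Qed.

(** Without a right special factor, deleting the last letter would be injective and the complexity
    would not grow. *)
Lemma step_right_special :
  exists i j, fac w i n = fac w j n /\ w (i + n) <> w (j + n).
Proof.
apply: contrapT => h.
suff : subword_complexity w n.+1 <= subword_complexity w n by rewrite step ltnn.
rewrite /subword_complexity -(@card_in_imset _ _ (@tuple_belast T n)); last first.
  move=> u v /factor_atP[i ->] /factor_atP[j ->]; rewrite !tuple_belast_factor.
  move=> /factor_at_eq e; apply/factor_at_eq/fac_succ_eq; split=> //.
  by apply: contrapT => ne; apply: h; exists i, j.
apply/subset_leq_card/subsetP=> x /imsetP[u /factor_atP[i ->] ->].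
by rewrite tuple_belast_factor mem_factor_at.
Qed.

End ComplexityStep.

(** * Balance of aperiodic binary words with unique right special factors *)

Section BinaryLanguages.

(** In an unbalanced pair of minimal length, trimming either end restores balance, which forces the
    outer letters. Comparing prefixes with prefixes and suffixes with suffixes makes the inner words
    equal; comparing prefixes with suffixes makes the inner word a palindrome. *)
Lemma unbalanced_palindrome (L : seq bool -> Prop) :
  (forall U V W, L (U ++ V ++ W) -> L V) ->
  (exists U V, [/\ L U, L V, size U = size V & (count id V).+1 < count id U]) ->
  exists X, [/\ rev X = X, L (true :: rcons X true) & L (false :: rcons X false)].
Proof.
move=> Linf; pose P n := `[< exists U V,
  [/\ L U, L V, size U = size V, (count id V).+1 < count id U & size U = n] >].
case=> U0 [V0 [LU0 LV0 sUV0 cUV0]].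
have exP : exists n, P n by exists (size U0); apply/asboolP; exists U0, V0.
case: (ex_minnP exP) => n /asboolP[U [V [LU LV sUV cUV sU]]] minn.
have bal U' V' : L U' -> L V' -> size U' = size V' -> size U' < n ->
    count id U' <= (count id V').+1.
  move=> LU' LV' s' lt; rewrite leqNgt; apply/negP => gt.
  have : P (size U') by apply/asboolP; exists U', V'.
  by move/minn; rewrite leqNgt lt.
case: U LU sUV cUV sU => [|x U] //; case: V LV => [|y V] //=.
case/lastP: U => [|X x']; first by case: x.
case/lastP: V => [|Y y']; first by rewrite size_rcons.
rewrite !size_rcons -!cats1 !count_cat /= !addn0.
move=> LY LX [sXY] gt sn.
have pre Z c c' k : L (c :: Z ++ [:: c']) -> L (c :: take k Z).
  move=> LZ; apply: (Linf [::] _ (drop k Z ++ [:: c'])).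
  by rewrite /= catA cat_take_drop.
have suf Z c c' k : L (c :: Z ++ [:: c']) -> L (drop k Z ++ [:: c']).
  move=> LZ; apply: (Linf (c :: take k Z) _ [::]).
  by rewrite cats0 /= catA cat_take_drop.
have b1 : count id X + x' <= (count id Y + y').+1.
  have := bal (X ++ [:: x']) (Y ++ [:: y']).
  have := suf X x x' 0 LX; have := suf Y y y' 0 LY; rewrite !drop0 => h1 h2.
  by rewrite !size_cat !count_cat /= !addn0 sXY; apply=> //; lia.
have b2 : x + count id X <= (y + count id Y).+1.
  have := bal (x :: X) (y :: Y).
  have := pre X x x' (size X) LX; have := pre Y y y' (size Y) LY.
  by rewrite !take_size /= => h1 h2; apply=> //; lia.
have [ex ey ex' ey' cXY] : [/\ x = true, y = false, x' = true, y' = false &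
    count id X = count id Y].
  by case: x y x' y' {LX LY} b1 b2 gt => [] [] [] [] /= *; split=> //; lia.
subst x y x' y'.
have cut (Z : seq bool) k : count id Z = count id (take k Z) + count id (drop k Z).
  by rewrite -count_cat cat_take_drop.
have eXY : X = Y.
  apply: eq_prefix_count => // k kX.
  have := bal _ _ (pre _ _ _ k LX) (pre _ _ _ k LY).
  have := bal _ _ (suf _ _ _ k LX) (suf _ _ _ k LY).
  rewrite /= !size_cat !count_cat /= !size_takel ?size_drop -?sXY // => h1 h2.
  have := h1 erefl ltac:(lia); have := h2 erefl ltac:(lia).
  by have := cut X k; have := cut Y k; lia.
subst Y; exists X; rewrite -!cats1; split=> //.
apply: eq_prefix_count; rewrite size_rev // => k kX.
have -> : count id (take k (rev X)) = count id (drop (size X - k) X).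
  by rewrite take_rev count_rev.
have := bal _ _ (pre _ _ _ k LX) (suf _ _ _ (size X - k) LY).
have := bal _ _ (suf _ _ _ (size X - k) LX) (pre _ _ _ k LY).
rewrite /= !size_cat !count_cat /= !size_takel ?size_drop //.
have -> : size X - (size X - k) + 1 = k.+1 by lia.
by move=> h1 h2; have := h1 erefl ltac:(lia); have := h2 erefl ltac:(lia); lia.
Qed.

Variable z : nat -> bool.
Hypothesis urs : uniq_right_special z.

(** Apart from the factors in [B], those ending in [true] whose last letter can be replaced by
    [false], a factor is determined by its prefix; uniqueness leaves at most one element in [B]. *)
Lemma binary_complexity_le n : subword_complexity z n <= n.+1.
Proof.
elim: n => [|n IH].
  by apply: leq_trans (max_card _) _; rewrite card_tuple.
pose B := [set u in factors z n.+1 | `[< exists i j,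
  [/\ u = factor_at z i n.+1, fac z i n = fac z j n, z (i + n) & ~~ z (j + n)] >]].
rewrite /subword_complexity -(cardsID B); apply: (@leq_add _ _ 1) => /=.
  apply: leq_trans (subset_leq_card (subsetIr _ _)) _.
  apply/card_le1_eqP => u v; rewrite !inE.
  case/andP=> _ /asboolP[i [i' [-> ei zi zi']]].
  case/andP=> _ /asboolP[j [j' [-> ej zj zj']]].
  apply/factor_at_eq/fac_succ_eq; split; last by rewrite zi zj.
  apply: (@urs n j j' i i') => //; first by rewrite zj (negbTE zj').
  by rewrite zi (negbTE zi').
apply: leq_trans IH; rewrite -(@card_in_imset _ _ (@tuple_belast _ n)); last first.
  move=> u v; rewrite !in_setD.
  move=> /andP[nu /factor_atP[i eu]] /andP[nv /factor_atP[j ev]]; subst u v.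
  rewrite !tuple_belast_factor => /factor_at_eq e.
  apply/factor_at_eq/fac_succ_eq; split=> //.
  case zi: (z (i + n)); case zj: (z (j + n)) => //.
    case/negP: nu; rewrite in_set mem_factor_at; apply/asboolP.
    by exists i, j; rewrite zi zj.
  case/negP: nv; rewrite in_set mem_factor_at; apply/asboolP.
  by exists j, i; rewrite zi zj.
apply/subset_leq_card/subsetP=> x /imsetP[u]; rewrite in_setD.
by case/andP=> _ /factor_atP[i ->] ->; rewrite tuple_belast_factor mem_factor_at.
Qed.

Hypothesis aper : aperiodic z.

(* Coven and Hedlund: an unbalanced pair gives a palindrome [X] with [cXc] a
   factor for both letters [c]; for one of them [cX] is not right special, and
   the other extension of [X] cannot occur near [cXc], which forces the
   windows of length [|X| + 1] to cycle. *)
Lemma right_special_balanced i0 j0 n :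
  count id (fac z i0 n) <= (count id (fac z j0 n)).+1.
Proof.
rewrite leqNgt; apply/negP => gt.
pose L (U : seq bool) := exists k, U = fac z k (size U).
have Linf U V W : L (U ++ V ++ W) -> L V.
  case=> k /esym /fac_catP[_ /esym /fac_catP[e _]]; by eexists; exact: e.
have [|X [palX [k1 LT] [k0 LF]]] := unbalanced_palindrome Linf.
  exists (fac z i0 n), (fac z j0 n); split; rewrite ?size_fac //.
    by exists i0; rewrite size_fac.
  by exists j0; rewrite size_fac.
set m := size X.
have occ (c : bool) : exists k, [/\ z k = c, fac z k.+1 m = X & z (k + m.+1) = c].
  have [k] : exists k, c :: rcons X c = fac z k m.+2.
    case: c; first by exists k1; rewrite {1}LT /= size_rcons.
    by exists k0; rewrite {1}LF /= size_rcons.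
  rewrite facS facSr => -[ec /eqP]; rewrite eqseq_rcons => /andP[/eqP eX /eqP ec'].
  by exists k; split; rewrite ?addnS -?addSn.
(* Otherwise [X] preceded by [true] and [X] preceded by [false] would be two right special factors
   of length [m.+1]. *)
have [c det] : exists c : bool, forall k, z k = c -> fac z k.+1 m = X ->
    z (k + m.+1) = c.
  have [k [zk fk zkm]] := occ true; have [l [zl fl zlm]] := occ false.
  have [dT|/existsNP[k' /not_implyP[zk' /not_implyP[fk' nk']]]] :=
    pselect (forall k, z k = true -> fac z k.+1 m = X -> z (k + m.+1) = true).
    by exists true.
  exists false => l' zl' fl'; apply: contrapT => nl'.
  have : fac z k m.+1 = fac z l m.+1.
    apply: (@urs m.+1 k k' l l'); rewrite ?zkm ?zlm //.
    - by rewrite !facS zk zk' fk fk'.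
    - exact: nesym.
    - by rewrite !facS zl zl' fl fl'.
    - exact: nesym.
  by rewrite !facS zk zl.
have [j [zj fj zjm]] := occ c; have [l [zl fl zlm]] := occ (~~ c).
pose win k := fac z k m.+1.
have nthX k : k < m -> z (j.+1 + k) = nth false X k.
  by move=> km; rewrite -fj nth_fac.
(* For 0 < o <= m, an occurrence of [~~ c :: X] at [j + o] would put [~~ c] at index o - 1 of [X]
   and [c] at the mirror index m - o. *)
have far o : o <= m.+1 -> win (j + o) <> ~~ c :: X.
  move=> om; rewrite /win facS => -[zo fo].
  have [o0|o0] := posnP o.
    by move: zo; rewrite o0 addn0 zj; case: (c).
  have [oe|om'] : o = m.+1 \/ o <= m by lia.
    by move: zo; rewrite oe zjm; case: (c).
  have e1 : nth false X o.-1 = ~~ c.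
    by rewrite -nthX; [rewrite -zo; congr z; lia | lia].
  have e2 : nth false X (m - o) = c.
    rewrite -fo nth_fac; last by lia.
    by rewrite -zjm; congr z; lia.
  move: e2; rewrite -palX nth_rev; last by rewrite -/m; lia.
  have -> : size X - (m - o).+1 = o.-1 by rewrite -/m; lia.
  by rewrite e1; case: (c).
(* If the next letters differed, the tail of the window would be right special, hence equal to [X];
   the head is then [c], and [det] fixes the next letter. *)
have next k k' : win k = win k' -> win k <> ~~ c :: X ->
    z (k + m.+1) = z (k' + m.+1).
  move=> e ne; apply: contrapT => nz.
  have eh : z k = z k' by move: e; rewrite /win !facS => -[].
  have et : fac z k.+1 m = fac z k'.+1 m by move: e; rewrite /win !facS => -[].
  have fk : fac z k.+1 m = X.
    rewrite -fj; apply: (@urs m k.+1 k'.+1 j.+1 l.+1) => //.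
    - by rewrite !addSnnS.
    - by rewrite fj fl.
    - by rewrite !addSnnS zjm zlm; case: (c).
  have zk : z k = c.
    have : z k <> ~~ c by move=> h; apply: ne; rewrite /win facS h fk.
    by case: (z k); case: (c).
  by apply: nz; rewrite !det // -?eh -?et.
(* Pigeonhole: the [m.+2] windows avoid [~~ c :: X], which leaves at most [m.+1] values. *)
have [o1 [o2 [o12 o2m e12]]] : exists o1 o2,
    [/\ o1 < o2, o2 <= m.+1 & win (j + o1) = win (j + o2)].
  apply: contrapT => h.
  pose f (o : 'I_m.+2) := factor_at z (j + o) m.+1.
  have finj : injective f.
    move=> o o' /factor_at_eq e; apply/val_inj/eqP.
    have := ltn_ord o; have := ltn_ord o' => lo' lo.
    case: ltngtP => // lt; exfalso; apply: h.
      by exists o, o'; split.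
    by exists o', o; split.
  have : #|f @: setT| <= #|factors z m.+1 :\ factor_at z l m.+1|.
    apply/subset_leq_card/subsetP=> x /imsetP[o _ ->].
    rewrite in_setD1 mem_factor_at andbT; apply/eqP => /factor_at_eq e.
    apply: (@far o); first by rewrite -ltnS.
    by rewrite /win e facS zl fl.
  rewrite card_imset // cardsT card_ord.
  have := cardsD1 (factor_at z l m.+1) (factors z m.+1).
  have := binary_complexity_le m.+1; rewrite /subword_complexity mem_factor_at.
  by move: #|_ :\ _| #|factors z _| => s t; lia.
pose q := o2 - o1.
(* For k < q the window is still in the range of [far]; from then on it equals one treated q steps
   earlier. So [z] is eventually periodic with period q. *)
have cyc k : win (j + o1 + k) = win (j + o2 + k) /\ win (j + o1 + k) <> ~~ c :: X.
  elim/ltn_ind: k => k IH.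
  have E : win (j + o1 + k) = win (j + o2 + k).
    case: k IH => [|k] IH; first by rewrite !addn0.
    have [e ne] := IH k (ltnSn k); have ez := next _ _ e ne.
    rewrite /win !facSr; congr rcons; last by rewrite !addnS !addSn -!addnS.
    by move: e; rewrite /win !facS => -[_]; rewrite !addnS.
  split=> //; have [lt|ge] := ltnP k q.
    by rewrite -addnA; apply: far; rewrite /q in lt; lia.
  have [e ne] := IH (k - q) ltac:(by rewrite /q in ge *; lia).
  have -> : j + o1 + k = j + o2 + (k - q) by rewrite /q in ge *; lia.
  by rewrite -e.
have [k kN] := aper (j + o1) (q := q) ltac:(rewrite /q; lia).
have [e _] := cyc (k - (j + o1)).
case; move: e; rewrite /win !facS => -[+ _].
have -> : j + o1 + (k - (j + o1)) = k by lia.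
by have -> : j + o2 + (k - (j + o1)) = k + q by rewrite /q; lia.
Qed.

End BinaryLanguages.

(** * Colorings of Sturmian words *)

Section Sturmian.
Variables (T : finType) (w : nat -> T).
Hypothesis st : sturmian w.

Lemma sturmian_step n : subword_complexity w n.+1 = (subword_complexity w n).+1.
Proof. by rewrite !st addSn. Qed.

Lemma sturmian_letter_balanced b i j n :
  count_mem b (fac w i n) <= (count_mem b (fac w j n)).+1.
Proof.
have [[k0 bk0]|nob] := pselect (exists k, w k = b); last first.
  rewrite (_ : count_mem b (fac w i n) = 0) //.
  by apply/count_memPn/negP => /mapP[k _ e]; apply: nob; exists k.
pose z n := w n == b.
(* The empty word has only two extensions, so [w] uses at most two letters and is determined by the
   occurrences of [b]. *)
have zw k l : z k = z l <-> w k = w l.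
  split=> [|e]; last by rewrite /z e.
  rewrite /z; case: eqP => [-> /esym/eqP -> //|nk /esym/eqP nl].
  have h := step_two_extensions (sturmian_step 0) (i := k) (j := k0) (k := l)
    erefl erefl.
  by move: h; rewrite !addn0 bk0 => /(_ nk)[].
have facz k l m : fac z k m = fac z l m <-> fac w k m = fac w l m.
  by split=> /eq_facP e; apply/eq_facP => s sm; apply/zw; apply: e.
have cz k m : count id (fac z k m) = count_mem b (fac w k m).
  by rewrite /fac !count_map.
rewrite -!cz; apply: right_special_balanced.
  move=> m k k' l l' /facz e1 n1 /facz e2 n2; apply/facz.
  apply: (step_uniq_right_special (sturmian_step m) e1 _ e2).
    by move/zw.
  by move/zw.
move=> N q q0.
have [|m Nm ne] := complexity_aperiodic (w := w) _ N q0.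
  by move=> m _; rewrite st addn1.
by exists m => // /zw.
Qed.


End Sturmian.

Section PairBalanced.
Variables (T : eqType) (w : nat -> T).

(** Projecting to a letter and its complement erases nothing, so the windows compared have equal
    length. *)
Lemma pair_balanced_letter x :
  (forall i j n, count_mem x (fac w i n) <= (count_mem x (fac w j n)).+1) ->
  pair_balanced w (pred1 x) (predC1 x) /\ pair_balanced w (predC1 x) (pred1 x).
Proof.
move=> bal.
have cT u : (count (predU (pred1 x) (predC1 x)) u = size u) *
            (count (predU (predC1 x) (pred1 x)) u = size u).
  by split; apply/eqP; rewrite -all_count; apply/allP => y _ /=; case: (y == x).
have cC u : count_mem x u + count (predC1 x) u = size u.
  by rewrite -(count_predC (pred1 x)).
split=> i n j m; rewrite !cT !size_fac => <-; first exact: bal.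
have := cC (fac w i n); have := cC (fac w j n); rewrite !size_fac.
by have := bal j i n; lia.
Qed.

End PairBalanced.

Section Color.
Variables (T : finType) (A B : {set T}) (w0 w1 : nat -> T) (a : T).
Hypothesis disAB : [disjoint A & B].
Hypothesis w0A : word_over A w0.
Hypothesis w1B : word_over B w1.

Local Notation w := (color w0 a w1).

Lemma colorE n :
  w n = if w0 n == a then w1 (count_mem a (fac w0 0 n)) else w0 n.
Proof.
rewrite /color; case: eqP => // e; congr w1.
by rewrite val_factor_at facSr -cats1 count_cat /= add0n e eqxx; lia.
Qed.

Lemma color_memB n : (w n \in B) = (w0 n == a).
Proof.
rewrite colorE; case: eqP => _; first by rewrite w1B.
by apply: (disjointFr disAB); apply: w0A.
Qed.

Lemma color_eq_notinB x n : x \notin B -> x != a -> (w n == x) = (w0 n == x).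
Proof.
move=> xB xa; have := color_memB n; rewrite colorE.
case: (eqVneq (w0 n) a) => [-> h|//].
by rewrite eq_sym [a == x]eq_sym (negbTE xa); apply/eqP => e; rewrite e h in xB.
Qed.

Lemma count_color_memB i n : count (mem B) (fac w i n) = count_mem a (fac w0 i n).
Proof.
by rewrite !count_map; apply: eq_count => k; rewrite /= color_memB.
Qed.

(** The letters of [B] in a window of the coloring form a factor of [w1], starting at the number of
    [a] read before the window. *)
Lemma count_color_inB x i n : x \in B ->
  count_mem x (fac w i n) =
  count_mem x (fac w1 (count_mem a (fac w0 0 i)) (count_mem a (fac w0 i n))).
Proof.
move=> xB; elim: n => [//|n IH].
rewrite !facSr -!cats1 !count_cat IH /= !addn0.
rewrite facD count_cat; congr (_ + _).
have := color_memB (i + n); rewrite colorE facD count_cat.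
case: (w0 (i + n) == a) => /= h; first by rewrite addn0.
by case: eqP => // e; rewrite -e h in xB.
Qed.

Lemma color_separated i j :
  sturmian w0 -> sturmian w1 -> w i != w j ->
  exists al be : pred T, [/\ al (w i), be (w j), (forall t, al t -> ~~ be t) &
    pair_balanced w al be].
Proof.
move=> st0 st1 ne.
have balA k : w k \notin B -> pair_balanced w (pred1 (w k)) (predC1 (w k)) /\
    pair_balanced w (predC1 (w k)) (pred1 (w k)).
  move=> kB; apply: pair_balanced_letter => i' j' n.
  have wka : w k != a.
    by move: kB; rewrite color_memB colorE => /negbTE h; rewrite h h.
  have cnt l : count_mem (w k) (fac w l n) = count_mem (w k) (fac w0 l n).
    by rewrite !count_map; apply: eq_count => s /=; apply: color_eq_notinB.
  by rewrite !cnt; apply: sturmian_letter_balanced.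
have [iB|/balA[bal _]] := boolP (w i \in B); last first.
  exists (pred1 (w i)), (predC1 (w i)); split=> //=; first by rewrite eq_sym.
  by move=> t /= ->.
have [jB|/balA[_ bal]] := boolP (w j \in B); last first.
  by exists (predC1 (w j)), (pred1 (w j)); split=> //=.
exists (pred1 (w i)), [pred t | (t \in B) && (t != w i)]; split=> //=.
- by rewrite jB eq_sym.
- by move=> t /= ->; rewrite andbF.
move=> k n l m.
have cB u : count (predU (pred1 (w i)) [pred t | (t \in B) && (t != w i)]) u =
    count (mem B) u.
  by apply: eq_count => t /=; case: eqP => [->|]; rewrite ?iB //= andbT.
(* Equal numbers of letters of [B] mean equally long factors of [w1], to which the balance of [w1]
   applies. *)
rewrite !cB !count_color_memB !count_color_inB // => ->.
exact: sturmian_letter_balanced.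
Qed.

End Color.

(** * Words of complexity n + d - 1 *)

Section TwoLetters.
Variables (T : eqType) (w : nat -> T) (a b : T).
Hypothesis ab_neq : a != b.

Local Notation ab := (predU (pred1 a) (pred1 b)).
Local Notation prj := (proj (pred1 a) (pred1 b)).

Definition next_letter (i : nat) (x : T) : Prop :=
  exists m, [/\ w (i + m) = x, ab x & forall k, k < m -> ~~ ab (w (i + k))].

Lemma next_letter_ab i x : next_letter i x -> ab x.
Proof. by case=> m []. Qed.

Lemma next_letter_inj i x y : next_letter i x -> next_letter i y -> x = y.
Proof.
move=> [m [ex abx hx]] [n [ey aby hy]].
case: (ltngtP m n) => [mn|nm|e]; last by rewrite -ex -ey e.
  by have := hy m mn; rewrite ex abx.
by have := hx n nm; rewrite ey aby.
Qed.

Lemma next_letter_here i : ab (w i) -> next_letter i (w i).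
Proof. by move=> abi; exists 0; rewrite addn0. Qed.

Lemma next_letter_skip i x : ~~ ab (w i) -> next_letter i.+1 x -> next_letter i x.
Proof.
move=> nab [m [ex abx hx]]; exists m.+1; split=> //; first by rewrite addnS.
by case=> [|k] km; rewrite ?addn0 // addnS; apply: hx.
Qed.

Lemma next_letterP i n : ab (w (i + n)) ->
  exists2 m, m <= n & ab (w (i + m)) /\ next_letter i (w (i + m)).
Proof.
move=> abn; have ex : exists m, ab (w (i + m)) by exists n.
case: (ex_minnP ex) => m abm min; exists m; first exact: min.
split=> //; exists m; split=> // k km; apply/negP => /min.
by rewrite leqNgt km.
Qed.

Lemma ab_eq x y : ab x -> ab y -> (x == a) = (y == a) -> x = y.
Proof.
rewrite /= => /orP[/eqP ->|/eqP ->] /orP[/eqP ->|/eqP ->] //; rewrite eqxx.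
  by rewrite eq_sym (negbTE ab_neq).
by rewrite eq_sym (negbTE ab_neq).
Qed.

Lemma proj_fac_next i n c U : prj (fac w i n) = c :: U ->
  exists2 x, next_letter i x & (x == a) = c.
Proof.
elim: n i => [//|n IH] i; rewrite facS /proj [filter _ _]/=.
case abi: (ab (w i)); rewrite /= in abi; rewrite abi.
  by case=> <- _; exists (w i) => //; apply: next_letter_here.
move/IH => [x nx xc]; exists x => //; apply: next_letter_skip => //=.
by rewrite abi.
Qed.

(** The two-letter factors of the projection, described without reference to a window. *)
Definition adjacent (c c' : bool) : Prop :=
  exists i x, [/\ ab (w i), (w i == a) = c, next_letter i.+1 x & (x == a) = c'].

Lemma proj_fac_adjacent i n c c' U :
  prj (fac w i n) = c :: c' :: U -> adjacent c c'.
Proof.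
elim: n i => [//|n IH] i; rewrite facS /proj [filter _ _]/=.
case abi: (ab (w i)); rewrite /= in abi; rewrite abi; last exact: IH.
by case=> <- /proj_fac_next[x nx xc]; exists i, x.
Qed.

(** Imbalance gives a palindrome [X] occurring between two [true] and between two [false]. If [X] is
    nonempty, its last letter has two successors; if it is empty, each letter only follows itself,
    so the projection is constant. *)
Lemma deterministic_pair_balanced :
  (forall i j x y, ab (w i) -> w i = w j ->
     next_letter i.+1 x -> next_letter j.+1 y -> x = y) ->
  pair_balanced w (pred1 a) (pred1 b).
Proof.
move=> det i0 n0 j0 m0 eqc; rewrite leqNgt; apply/negP => gt.
have adj_fun c c1 c2 : adjacent c c1 -> adjacent c c2 -> c1 = c2.
  move=> [i [x [abi ic nx <-]]] [j [y [abj jc ny <-]]].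
  by rewrite (det i j x y) //; apply: ab_eq => //; rewrite ic jc.
pose L U := exists i n, U = prj (fac w i n).
have Linf U V W : L (U ++ V ++ W) -> L V.
  by case=> i [n /esym /proj_infix].
have Ladj U c c' V : L (U ++ [:: c; c'] ++ V) -> adjacent c c'.
  by move/Linf => [i [n /esym /proj_fac_adjacent]].
have [|X [_ LT LF]] := unbalanced_palindrome Linf.
  exists (prj (fac w i0 n0)), (prj (fac w j0 m0)).
  rewrite !size_proj !count_proj eqc.
  by split=> //; [exists i0, n0 | exists j0, m0].
case/lastP: X LT LF => [|X c] LT LF; last first.
  have adj d : L (d :: rcons (rcons X c) d) -> adjacent c d.
    by rewrite -!cats1 -catA => /(Ladj (d :: X) c d [::]).
  by have := adj_fun _ _ _ (adj _ LT) (adj _ LF).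
have aT := Ladj [::] _ _ [::] LT; have aF := Ladj [::] _ _ [::] LF.
have const i n : ab (w i) -> ab (w (i + n)) -> (w i == a) = (w (i + n) == a).
  elim/ltn_ind: n i => -[|n] IH i abi; first by rewrite addn0.
  rewrite -addSnnS => abn; have [m mn [abm nm]] := next_letterP abn.
  have -> : w i == a = (w (i.+1 + m) == a).
    have : adjacent (w i == a) (w (i.+1 + m) == a) by exists i, (w (i.+1 + m)).
    case: (w i == a) => h; first exact: (adj_fun _ _ _ aT h).
    exact: (adj_fun _ _ _ aF h).
  have := IH (n - m) _ (i.+1 + m) abm; rewrite -addnA subnKC //.
  by apply=> //; rewrite ltnS leq_subr.
case: aT => i [x [abi ia _ _]]; case: aF => j [y [abj ja _ _]].
have [ij|/ltnW ji] := leqP i j.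
  by have := const i (j - i) abi; rewrite subnKC // ia ja => /(_ abj).
by have := const j (i - j) abj; rewrite subnKC // ia ja => /(_ abi).
Qed.

(** * The infinite projected word when branchings of the word remain visible *)

Section Branching.
Hypothesis ab_inf : forall N, exists2 k, N <= k & ab (w k).
Hypothesis branch : forall i j, w i = w j -> w i.+1 <> w j.+1 ->
  exists x y, [/\ next_letter i.+1 x, next_letter j.+1 y & x <> y].
Hypothesis urs : uniq_right_special w.
Hypothesis aper : aperiodic w.

Definition ab_count K := count ab (fac w 0 K).

Lemma ab_countD K m : ab_count (K + m) = ab_count K + count ab (fac w K m).
Proof. by rewrite /ab_count facD count_cat. Qed.

Lemma ab_countS K : ab_count K.+1 = ab_count K + ab (w K).
Proof. by rewrite -addn1 ab_countD /= addn0. Qed.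

Lemma ab_count_lt K K' : ab (w K) -> K < K' -> ab_count K < ab_count K'.
Proof.
by move=> abK KK'; rewrite -(subnKC KK') ab_countD ab_countS abK addn1 leq_addr.
Qed.

Lemma ab_position k : exists K, ab (w K) && (ab_count K == k).
Proof.
elim: k => [|k [K /andP[abK /eqP cK]]].
  have [n _ abn] := ab_inf 0.
  have [m0 _ [_ [m [e abm h]]]] := next_letterP (i := 0) abn.
  exists (0 + m); rewrite e abm /= /ab_count.
  rewrite -leqn0 leqNgt -has_count; apply/hasPn => x /mapP[k].
  by rewrite mem_iota => /andP[_ lt] ->; apply: h.
have [n Kn abn] := ab_inf K.+1; rewrite -(subnKC Kn) in abn.
have [m0 _ [_ [m [e abm h]]]] := next_letterP abn.
exists (K.+1 + m); rewrite e abm ab_countD ab_countS abK cK addn1.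
suff -> : count ab (fac w K.+1 m) = 0 by rewrite addn0 eqxx.
apply/eqP; rewrite -leqn0 leqNgt -has_count; apply/hasPn => x /mapP[l].
rewrite mem_iota => /andP[le lt] ->; rewrite -(subnKC le).
by apply: h; lia.
Qed.

(** The position in [w] of the letter with index [k] in the projected word; [ab_count] maps it back
    to [k]. *)
Definition ab_pos k := xchoose (ab_position k).
Definition ab_word k : bool := w (ab_pos k) == a.

Local Notation z := ab_word.

Lemma ab_posP k : ab (w (ab_pos k)) /\ ab_count (ab_pos k) = k.
Proof. by have /andP[? /eqP] := xchooseP (ab_position k). Qed.

Lemma ab_word_count K : ab (w K) -> z (ab_count K) = (w K == a).
Proof.
move=> abK; have [abp cp] := ab_posP (ab_count K); rewrite /ab_word.
case: (ltngtP (ab_pos (ab_count K)) K) => [lt|gt|-> //].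
  by have := ab_count_lt abp lt; rewrite cp ltnn.
by have := ab_count_lt abK gt; rewrite cp ltnn.
Qed.

Lemma proj_fac K m :
  prj (fac w K m) = fac z (ab_count K) (count ab (fac w K m)).
Proof.
elim: m K => [//|m IH] K; rewrite facS /proj [filter _ _]/= [count _ _]/=.
have e := ab_countS K.
case abK: (ab (w K)); rewrite /= in abK e; rewrite abK in e *.
  rewrite add1n facS /= -/(prj _) IH e addn1; congr (_ :: _).
  by rewrite ab_word_count //= abK.
by rewrite add0n -/(prj _) IH e addn0.
Qed.

Lemma next_letter_word K x : next_letter K x -> z (ab_count K) = (x == a).
Proof.
case=> m [ex abx h].
suff <- : ab_count (K + m) = ab_count K by rewrite ab_word_count ?ex.
rewrite ab_countD; suff -> : count ab (fac w K m) = 0 by rewrite addn0.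
apply/eqP; rewrite -leqn0 leqNgt -has_count; apply/hasPn => y /mapP[k].
by rewrite mem_iota => /andP[le lt] ->; rewrite -(subnKC le); apply: h; lia.
Qed.

Lemma same_word K K' m s : fac w K m = fac w K' m ->
  s < count ab (fac w K m) -> z (ab_count K + s) = z (ab_count K' + s).
Proof.
move=> e sc; have := proj_fac K' m; rewrite -e proj_fac => /eq_facP; exact.
Qed.

(** At the first disagreement the preceding letters agree, so [branch] makes the next kept letters
    differ. *)
Lemma diverge K K' s : w K = w K' -> w (K + s) <> w (K' + s) ->
  exists m, [/\ fac w K m = fac w K' m, w (K + m) <> w (K' + m) &
    z (ab_count K + count ab (fac w K m)) <> z (ab_count K' + count ab (fac w K m))].
Proof.
move=> e0 /eqP ns; have ex : exists m, w (K + m) != w (K' + m) by exists s.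
case: (ex_minnP ex) => -[|m] nm min; first by rewrite !addn0 e0 eqxx in nm.
have e k : k < m.+1 -> w (K + k) = w (K' + k).
  by move=> km; apply/eqP/negPn/negP => /min; rewrite leqNgt km.
have ef : fac w K m.+1 = fac w K' m.+1 by apply/eq_facP.
exists m.+1; split=> //; first exact/eqP.
rewrite -ab_countD ef -ab_countD.
have [|x [y [nx ny xy]]] := branch (e m (ltnSn m)); first by rewrite -!addnS; apply/eqP.
rewrite !addnS (next_letter_word nx) (next_letter_word ny) => h; apply: xy.
by apply: ab_eq h; [apply: next_letter_ab nx | apply: next_letter_ab ny].
Qed.

(** A period [q] from [N] on would give equal letters of [w] at the positions of indices [N] and
    [N + q]; aperiodicity of [w] makes it diverge from there, and [diverge] carries this over to
    [z]. *)
Lemma ab_word_aperiodic : aperiodic z.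
Proof.
move=> N q q0; apply: contrapT => h.
have per k : N <= k -> z (k + q) = z k.
  by move=> Nk; apply: contrapT => ne; apply: h; exists k.
have [abK cK] := ab_posP N; have [abK' cK'] := ab_posP (N + q).
set K := ab_pos N in abK cK; set K' := ab_pos (N + q) in abK' cK'.
have eK : w K = w K'.
  by apply: ab_eq => //; rewrite -!ab_word_count // cK cK' per.
have KK' : K < K'.
  rewrite ltnNge leq_eqVlt; apply/negP => /orP[/eqP e|lt].
    by move: cK'; rewrite e cK; lia.
  by have := ab_count_lt abK' lt; rewrite cK cK'; lia.
have [s Ks ns] := aper K (q := K' - K) ltac:(by rewrite subn_gt0).
have [|m [_ _]] := @diverge K K' (s - K) eK.
  have -> : K + (s - K) = s by lia.
  have -> : K' + (s - K) = s + (K' - K) by lia.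
  exact: nesym.
rewrite cK cK'; set c := count _ _; apply.
by rewrite -(per (N + c)) ?leq_addr //; congr z; lia.
Qed.

(** The first divergence of [w] after the two positions has exactly [n] kept letters before it:
    fewer would contradict the equality of the factors of [z], more the difference of their next
    letters. *)
Lemma lift_right_special n i i' : 0 < n ->
  fac z i n = fac z i' n -> z (i + n) <> z (i' + n) ->
  exists K K' m, [/\ fac w K m = fac w K' m, w (K + m) <> w (K' + m),
    ab_count K = i & count ab (fac w K m) = n].
Proof.
move=> n0 /eq_facP e ne.
have [abK cK] := ab_posP i; have [abK' cK'] := ab_posP i'.
set K := ab_pos i in abK cK; set K' := ab_pos i' in abK' cK'.
have eK : w K = w K'.
  apply: ab_eq => //; rewrite -!ab_word_count // cK cK'.
  by have := e 0 n0; rewrite !addn0.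
have [s ns] : exists s, w (K + s) <> w (K' + s).
  apply: contrapT => h; apply: ne.
  have [abQ cQ] := ab_posP (i + n); set Q := ab_pos (i + n) in abQ cQ.
  have KQ : K <= Q.
    by rewrite leqNgt; apply/negP => /(ab_count_lt abQ); rewrite cK cQ; lia.
  have := @same_word K K' (Q.+1 - K) n; rewrite cK cK'; apply.
    by apply/eq_facP => k _; apply: contrapT => nk; apply: h; exists k.
  have := ab_countD K (Q.+1 - K); rewrite subnKC ?leqW // cK.
  by have := ab_count_lt abQ (ltnSn Q); rewrite cQ; lia.
have [m [ef nm nz]] := diverge eK ns; exists K, K', m; split=> //.
rewrite cK cK' in nz; case: (ltngtP (count ab (fac w K m)) n) => // lt.
  by case: nz; apply: e.
by case: ne; have := same_word ef lt; rewrite cK cK'.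
Qed.

(** After lifting to [w], the shorter right special factor is a suffix of the longer one. Both keep
    [N] letters, so the extra prefix keeps none and the projections agree. *)
Lemma ab_word_urs : uniq_right_special z.
Proof.
move=> [|n] i i' j j' //; set N := n.+1 => ei ni ej nj.
have key k l K K' m H H' s :
    fac w K m = fac w K' m -> w (K + m) <> w (K' + m) ->
    ab_count K = k -> count ab (fac w K m) = N ->
    fac w H s = fac w H' s -> w (H + s) <> w (H' + s) ->
    ab_count H = l -> count ab (fac w H s) = N -> m <= s ->
    fac z k N = fac z l N.
  move=> eK nK cK NK eH nH cH NH ms.
  have eKH : fac w K m = fac w (H + (s - m)) m.
    apply: (@urs m K K' _ (H' + (s - m))) => //.
      apply/eq_facP => t tm; rewrite -!addnA.
      by move/eq_facP: eH; apply; lia.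
    by rewrite -!addnA subnK.
  have c0 : count ab (fac w H (s - m)) = 0.
    move: NH; rewrite -{1}(subnK ms) facD count_cat -eKH NK; lia.
  have := proj_fac K m; rewrite {1}eKH proj_fac -eKH NK cK ab_countD c0 addn0 cH.
  by move=> ->.
have [K [K' [m [eK nK cK NK]]]] := lift_right_special (ltn0Sn n) ei ni.
have [H [H' [s [eH nH cH NH]]]] := lift_right_special (ltn0Sn n) ej nj.
have [ms|/ltnW sm] := leqP m s.
  exact: (key i j K K' m H H' s).
by apply/esym; apply: (key j i H H' s K K' m).
Qed.

Lemma branching_pair_balanced : pair_balanced w (pred1 a) (pred1 b).
Proof.
move=> i n j m e; rewrite -!(count_proj (pred1 a) (pred1 b)) !proj_fac e.
by apply: right_special_balanced; [exact: ab_word_urs | exact: ab_word_aperiodic].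
Qed.

End Branching.
End TwoLetters.

(** * The right special letter and the choice between the two cases *)

Section MinimalComplexity.
Variables (T : finType) (w : nat -> T) (d : nat).
Hypothesis d2 : 2 <= d.
Hypothesis cplx : forall n, 0 < n -> subword_complexity w n = n + (d - 1).

Lemma minimal_complexity_step n : 0 < n ->
  subword_complexity w n.+1 = (subword_complexity w n).+1.
Proof. by move=> n0; rewrite !cplx. Qed.

Lemma minimal_complexity_urs : uniq_right_special w.
Proof.
case=> [|n] // i i' j j'.
exact: (step_uniq_right_special (minimal_complexity_step (ltn0Sn n))).
Qed.

Lemma minimal_complexity_aperiodic : aperiodic w.
Proof. by apply: complexity_aperiodic => n n0; rewrite cplx //; lia. Qed.

Lemma fac1 i : fac w i 1 = [:: w i]. Proof. by []. Qed.

Lemma minimal_complexity_pair_balanced a b :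
  a != b -> pair_balanced w (pred1 a) (pred1 b).
Proof.
move=> ab_neq; have step1 := minimal_complexity_step (ltn0Sn 0).
have [i0 [j0 [[er] nr]]] := step_right_special step1; rewrite !addn1 in nr.
pose r := w i0.
have det i j : w i = w j -> w i <> r -> w i.+1 = w j.+1.
  move=> e ne; apply: contrapT => ne'; apply: ne.
  suff [] : fac w i 1 = fac w i0 1 by [].
  by apply: (@minimal_complexity_urs 1 i j i0 j0); rewrite ?addn1 ?fac1 ?e ?er.
have two i j k : w i = r -> w j = r -> w k = r -> w i.+1 <> w j.+1 ->
    w k.+1 = w i.+1 \/ w k.+1 = w j.+1.
  move=> ei ej ek; rewrite -[i.+1]addn1 -[j.+1]addn1 -[k.+1]addn1.
  by apply: (step_two_extensions step1); rewrite !fac1 ei ?ej ?ek.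
have det_path i j m : w i = w j -> (forall k, k < m -> w (i + k) <> r) ->
    w (i + m) = w (j + m).
  move=> e; elim: m => [|m IH] h; first by rewrite !addn0.
  rewrite !addnS; apply: det; last exact: h.
  by apply: IH => k km; apply: h; apply: ltnW.
(* Without [r], each letter determines the next, and a repeated letter would make [w] eventually
   periodic. *)
have r_inf N : exists2 k, N <= k & w k = r.
  apply: contrapT => h.
  have nr' k : N <= k -> w k <> r by move=> Nk e; apply: h; exists k.
  have [o1 [o2 [lt e]]] : exists o1 o2, o1 < o2 /\ w (N + o1) = w (N + o2).
    apply: contrapT => no.
    have inj : injective (fun o : 'I_#|T|.+1 => w (N + o)).
      move=> o o' e; apply/val_inj/eqP; case: ltngtP => // lt; exfalso; apply: no.
        by exists o, o'.
      by exists o', o.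
    by have := leq_card _ inj; rewrite card_ord ltnn.
  have [n Nn] := minimal_complexity_aperiodic (N + o1) (q := o2 - o1) ltac:(lia).
  apply; have := det_path _ _ (n - (N + o1)) e.
  have -> : N + o1 + (n - (N + o1)) = n by lia.
  have -> : N + o2 + (n - (N + o1)) = n + (o2 - o1) by lia.
  by move=> -> // k _; apply: nr'; lia.
pose ab := predU (pred1 a) (pred1 b).
(* The first kept letter from [i] on is [x], and [r] is not met before it; this depends only on the
   letter [w i]. *)
pose hit i x := exists m, [/\ w (i + m) = x, ab x &
  forall k, k < m -> ~~ ab (w (i + k)) /\ w (i + k) <> r].
have hit_next i x : hit i x -> next_letter w a b i x.
  by case=> m [e abx h]; exists m; split=> // k /h[].
have hit_det i j x : w i = w j -> hit i x -> hit j x.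
  move=> e [m [em abx h]].
  have eq k : k <= m -> w (i + k) = w (j + k).
    by move=> km; apply: det_path => // l lk; case: (h l (leq_trans lk km)).
  exists m; split=> //; first by rewrite -eq.
  by move=> k km; rewrite -eq ?(ltnW km) //; apply: h.
have next_hit i x : next_letter w a b i.+1 x ->
    (exists k, w k = r /\ hit k.+1 x) \/
    (forall j, w i = w j -> next_letter w a b j.+1 x).
  case=> m [em abx h].
  (* If [r] is met on the way, its last occurrence before the kept letter gives a [hit]; otherwise
     the whole path is determined by [w i]. *)
  have [exr|nor] := pselect (exists k, (k <= m) && (w (i + k) == r)); [left|right].
    have bnd k : (k <= m) && (w (i + k) == r) -> k <= m by case/andP.
    case: (ex_maxnP exr bnd) => k /andP[km /eqP ek] max.
    exists (i + k); split=> //; exists (m - k); split=> //.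
      by rewrite -em; congr w; lia.
    move=> l lm; have -> : (i + k).+1 + l = i.+1 + (k + l) by lia.
    split; first by apply: h; lia.
    move=> e; have : k + l.+1 <= k.
      apply: max; have -> : i + (k + l.+1) = i.+1 + (k + l) by lia.
      by rewrite e eqxx andbT; lia.
    lia.
  move=> j e.
  have eq k : k <= m.+1 -> w (i + k) = w (j + k).
    move=> km; apply: det_path => // l lk el; apply: nor; exists l.
    by rewrite el eqxx andbT; lia.
  have eqS k : k <= m -> w (j.+1 + k) = w (i.+1 + k).
    by move=> km; rewrite !addSnnS eq.
  exists m; split=> //; first by rewrite eqS.
  by move=> k km; rewrite eqS ?(ltnW km) //; apply: h.
have [P|nP] := pselect (forall i j x y, ab (w i) -> w i = w j ->
    next_letter w a b i.+1 x -> next_letter w a b j.+1 y -> x = y).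
  exact: deterministic_pair_balanced.
have [i [j [x [y [eij nx ny xy]]]]] : exists i j x y, [/\ w i = w j,
    next_letter w a b i.+1 x, next_letter w a b j.+1 y & x <> y].
  apply: contrapT => h; apply: nP => i j x y _ e nx ny.
  by apply: contrapT => xy; apply: h; exists i, j, x, y.
(* Since [x] and [y] differ, both paths pass through [r]; its two successors then lead to [x] and
   [y] without returning to [r]. *)
have [k [rk hk]] : exists k, w k = r /\ hit k.+1 x.
  case: (next_hit _ _ nx) => // /(_ j eij) nx'.
  by case: xy; apply: next_letter_inj nx' ny.
have [l [rl hl]] : exists k, w k = r /\ hit k.+1 y.
  case: (next_hit _ _ ny) => // /(_ i (esym eij)) ny'.
  by case: xy; apply: next_letter_inj nx ny'.
have nkl : w k.+1 <> w l.+1.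
  move=> e; apply: xy; apply: (@next_letter_inj _ w a b l.+1); apply: hit_next => //.
  exact: hit_det hk.
have kl m : w m = r -> w m.+1 = w k.+1 \/ w m.+1 = w l.+1.
  by move=> em; apply: two.
apply: branching_pair_balanced => //.
- move=> N; have [m Nm em] := r_inf N.
  have [t [abt [s [es _ _]]]] : exists t, ab t /\ next_letter w a b m.+1 t.
    have nl t : hit m.+1 t -> ab t /\ next_letter w a b m.+1 t.
      by move/hit_next => nt; split=> //; apply: next_letter_ab nt.
    by case: (kl m em) => e; [exists x | exists y]; apply: nl;
      [apply: hit_det hk | apply: hit_det hl].
  by exists (m.+1 + s); [lia | rewrite es].
- move=> m m' e ne.
  have em : w m = r by apply: contrapT => nm; apply: ne; apply: det.
  have em' : w m' = r by rewrite -e.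
  case: (kl m em) (kl m' em') => e1 [] e2; try by case: ne; rewrite e1 e2.
    exists x, y; split=> //; apply: hit_next.
      by apply: hit_det hk.
    by apply: hit_det hl.
  exists y, x; split; [| |exact: nesym]; apply: hit_next.
    by apply: hit_det hl.
  by apply: hit_det hk.
- exact: minimal_complexity_urs.
- exact: minimal_complexity_aperiodic.
Qed.

End MinimalComplexity.

(** * Choice of the separating classes in the four cases *)

Theorem theorem1 (R : realType) (d : nat) (hd : 2 <= d) :
  [/\ (forall (T : finType) (w : nat -> T),
         #|T| = d -> balanced 1 w ->
         forall n : nat, binom_complexity 2 w n = subword_complexity w n),
      (forall (T : finType) (w : nat -> T),
         #|T| = d ->
         (forall n : nat, 0 < n -> subword_complexity w n = n + (d - 1)) ->
         forall n : nat, binom_complexity 2 w n = subword_complexity w n),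
      (forall w : nat -> 'I_d,
         billiard_word R w ->
         forall n : nat, binom_complexity 2 w n = subword_complexity w n) &
      (forall (T : finType) (A B : {set T}) (w0 w1 : nat -> T) (a : T),
         [disjoint A & B] -> word_over A w0 -> word_over B w1 -> a \in A ->
         sturmian w0 -> sturmian w1 ->
         forall (w : nat -> T), w = color w0 a w1 ->
         forall n : nat, binom_complexity 2 w n = subword_complexity w n)].
Proof.
have pred1_disjoint (T : finType) (x y t : T) : x != y -> pred1 x t -> ~~ pred1 y t.
  by move=> xy /eqP ->.
split.
- move=> T w _ bal; apply: binom_complexity_eq => i j ne.
  exists (pred1 (w i)), (pred1 (w j)); split=> //=.
    by move=> t; apply: pred1_disjoint.
  exact: balanced1_pair_balanced.
- move=> T w _ cplx; apply: binom_complexity_eq => i j ne.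
  exists (pred1 (w i)), (pred1 (w j)); split=> //=.
    by move=> t; apply: pred1_disjoint.
  exact: (minimal_complexity_pair_balanced hd cplx ne).
- move=> w [x [theta [cube [p [th [tau [px _ bounce]]]]]]].
  apply: binom_complexity_eq => i j ne.
  exists (pred1 (w i)), (pred1 (w j)); split=> //=.
    by move=> t; apply: pred1_disjoint.
  by apply: (@billiard_pair_balanced R d p th tau w) => //; rewrite px.
- move=> T A B w0 w1 a dis w0A w1B _ st0 st1 w ->.
  by apply: binom_complexity_eq => i j; move/(color_separated dis w0A w1B st0 st1).
Qed.
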